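(* Let $q\in\mathbb{C}$ with $0<|q|<1$, let $\alpha$ be a positive integer, and let $\chi$ be a Dirichlet character with odd conductor $d$. Then $$\mathcal{L}_{q}^{\chi}(0,x\mid\alpha)=\frac{[2:q]}{[2:q^{d}]}\sum_{l=0}^{d-1}(-1)^{l}\chi(l)q^{l}.$$
   Context: For $Q\neq 1$, $[y:Q]=\frac{Q^{y}-1}{Q-1}$. A value of $\log q$ is fixed and $q^{t}=\exp(t\log q)$. For real $x>0$ the Dirichlet $q$-$L$-function with weight $\alpha$ is $$\mathcal{L}_{q}^{\chi}(s,x\mid\alpha)=[2:q]\sum_{m=0}^{\infty}\frac{q^{m}\chi(m)(-1)^{m}}{[x+m:q^{\alpha}]^{s}},\qquad s\in\mathbb{C},$$ with complex powers defined by the principal branch. At $s=0$ every denominator equals $1$. *)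

(* Defs.v *)
From Stdlib Require Import Reals ZArith Arith.
From Coquelicot Require Import Coquelicot.

Local Open Scope C_scope.

Definition Cexp (z : C) : C :=
  RtoC (exp (Re z)) * (cos (Im z), sin (Im z)).

(* Principal argument, with values in (-PI, PI]; Carg 0 is a junk value. *)
Definition Carg (z : C) : R :=
  if Rle_dec 0 (Im z) then acos (Re z / Cmod z) else (- acos (Re z / Cmod z))%R.

Definition Clog (z : C) : C := (ln (Cmod z), Carg z).

(* Principal branch of z ^ s, meaningful for z <> 0. *)
Definition Cpower (z s : C) : C := Cexp (s * Clog z).

(* [y : Q] where Q is given through a chosen value logQ of its logarithm, so
   that Q = exp logQ and Q ^ y = exp (y logQ); it is meaningful for Q <> 1. *)
Definition qbracket (y logQ : C) : C :=
  (Cexp (y * logQ) - 1) / (Cexp logQ - 1).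

(* Sum of a complex series; it is meaningful when the series converges. *)
Definition CSeries (a : nat -> C) : C :=
  (Series (fun m => Re (a m)), Series (fun m => Im (a m))).

Definition dirichlet_character (N : nat) (chi : Z -> C) : Prop :=
  (0 < N)%nat /\
  chi 1%Z = 1 /\
  (forall a b : Z, chi (a * b)%Z = chi a * chi b) /\
  (forall a : Z, chi (a + Z.of_nat N)%Z = chi a) /\
  (forall a : Z, chi a <> 0 <-> Z.gcd a (Z.of_nat N) = 1%Z).

Definition induced_from (N : nat) (chi : Z -> C) (f : nat) : Prop :=
  Nat.divide f N /\
  exists psi : Z -> C, dirichlet_character f psi /\
    forall a : Z, Z.gcd a (Z.of_nat N) = 1%Z -> chi a = psi a.

Definition is_conductor (N : nat) (chi : Z -> C) (f : nat) : Prop :=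
  induced_from N chi f /\
  forall g : nat, induced_from N chi g -> (f <= g)%nat.

(* A character of conductor d is taken in its primitive form, defined modulo
   its conductor: for an imprimitive character of modulus N and conductor d < N,
   the values at integers sharing a factor with N are not d-periodic. *)
Definition dirichlet_character_of_conductor (d : nat) (chi : Z -> C) : Prop :=
  dirichlet_character d chi /\ is_conductor d chi d.

(* Here logq is the fixed value of log q, and the logarithm of q ^ alpha is
   alpha * logq, so that (q ^ alpha) ^ t = q ^ (alpha * t). *)
Definition qL_term (q logq : C) (chi : Z -> C) (alpha : nat)
    (s : C) (x : R) (m : nat) : C :=
  Cpow q m * chi (Z.of_nat m) * Cpow (- (1)) m /
  Cpower (qbracket (RtoC (x + INR m)) (RtoC (INR alpha) * logq)) s.

Definition qL (q logq : C) (chi : Z -> C) (alpha : nat) (s : C) (x : R) : C :=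
  qbracket 2 logq * CSeries (qL_term q logq chi alpha s x).

(* Main.v *)
Require Import Defs.
From Stdlib Require Import Reals ZArith Arith Lia Lra.
From Coquelicot Require Import Coquelicot.

(** At [s = 0] every complex power in the series is [1], so its [m]-th term is
    [w ^ m * chi m] with [w = - q], which has modulus less than [1].  Since
    [chi] takes finitely many values, the series converges by comparison with a
    geometric one ([ex_series_pow_periodic]).

    Shifting the index by the period [d] multiplies the terms by [w ^ d].
    Splitting off the first [d] terms therefore gives [S = P + w ^ d * S], where
    [P] is the finite sum over one period, and [S = P / (1 - w ^ d)]
    ([is_series_quasi_periodic]).  As [d] is odd, [1 - w ^ d = 1 + q ^ d], and
    this is the bracket [2 : q ^ d] because
    [(Q ^ 2 - 1) / (Q - 1) = 1 + Q] when [Q <> 1] ([qbracket_2]). *)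

Local Open Scope C_scope.

Lemma Cexp_0 : Cexp 0 = 1.
Proof.
  unfold Cexp; simpl.
  rewrite exp_0, cos_0, sin_0.
  apply Cmult_1_l.
Qed.

Lemma Cexp_plus (y z : C) : Cexp (y + z) = Cexp y * Cexp z.
Proof.
  destruct y as [a b], z as [c e].
  unfold Cexp, Cmult, Cplus, RtoC; simpl.
  rewrite exp_plus, cos_plus, sin_plus.
  f_equal; ring.
Qed.

Lemma Cexp_INR_mult (n : nat) (z : C) : Cexp (RtoC (INR n) * z) = Cpow (Cexp z) n.
Proof.
  induction n as [|n IH].
  - simpl INR. rewrite Cmult_0_l. apply Cexp_0.
  - rewrite S_INR, RtoC_plus, Cpow_S, <- IH, <- Cexp_plus.
    f_equal; ring.
Qed.

Lemma Cpower_0_r (z : C) : Cpower z 0 = 1.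
Proof. unfold Cpower. rewrite Cmult_0_l. apply Cexp_0. Qed.

Lemma qbracket_2 (z : C) : Cexp z <> 1 -> qbracket 2 z = 1 + Cexp z.
Proof.
  intros Hz. unfold qbracket.
  replace (2 * z) with (z + z) by ring.
  rewrite Cexp_plus.
  field. intros H. apply Hz.
  replace (Cexp z) with (Cexp z - 1 + 1) by ring.
  rewrite H. ring.
Qed.

Lemma Cmod_lt_1_neq_1 (z : C) : (Cmod z < 1)%R -> z <> 1.
Proof. intros H ->. rewrite Cmod_1 in H. lra. Qed.

Lemma Cmod_pow_lt_1 (z : C) (n : nat) :
  (0 < n)%nat -> (Cmod z < 1)%R -> (Cmod (Cpow z n) < 1)%R.
Proof.
  intros Hn Hz. rewrite Cmod_pow, <- (pow1 n).
  destruct n as [|n]; [lia|].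
  assert (H0 := Cmod_ge_0 z).
  assert (H1 : (Cmod z ^ n <= 1)%R).
  { rewrite <- (pow1 n). apply pow_incr. lra. }
  rewrite pow1. simpl. nra.
Qed.

Lemma Cpow_opp_odd (z : C) (n : nat) : Nat.Odd n -> Cpow (- z) n = - Cpow z n.
Proof.
  intros [k ->].
  rewrite !Cpow_add_r, !Cpow_mult_r, !Cpow_1_r.
  replace (Cpow (- z) 2) with (Cpow z 2) by (simpl; ring).
  ring.
Qed.

Lemma sum_n_Re (a : nat -> C) (n : nat) :
  Re (sum_n a n) = sum_n (fun m => Re (a m)) n.
Proof.
  induction n as [|n IH].
  - now rewrite !sum_O.
  - now rewrite !sum_Sn, <- IH.
Qed.

Lemma sum_n_Im (a : nat -> C) (n : nat) :
  Im (sum_n a n) = sum_n (fun m => Im (a m)) n.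
Proof.
  induction n as [|n IH].
  - now rewrite !sum_O.
  - now rewrite !sum_Sn, <- IH.
Qed.

(** The topology of [C] is the product topology, so the two coordinate
    projections are continuous and carry a limit of partial sums to the limits
    of its real and imaginary parts. *)
Lemma CSeries_unique (a : nat -> C) (l : C) : is_series a l -> CSeries a = l.
Proof.
  intros H. destruct l as [u v]. unfold CSeries. f_equal.
  - apply is_series_unique. unfold is_series.
    apply filterlim_ext with (fun n => Re (sum_n a n)).
    { apply sum_n_Re. }
    apply filterlim_comp with (1 := H).
    apply (continuous_fst (U := R_UniformSpace) (V := R_UniformSpace) u v).
  - apply is_series_unique. unfold is_series.
    apply filterlim_ext with (fun n => Im (sum_n a n)).
    { apply sum_n_Im. }
    apply filterlim_comp with (1 := H).
    apply (continuous_snd (U := R_UniformSpace) (V := R_UniformSpace) u v).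
Qed.

Lemma periodic_bounded (b : nat -> C) (d : nat) :
  (0 < d)%nat -> (forall m, b (d + m)%nat = b m) ->
  exists M : R, forall m, (Cmod (b m) <= M)%R.
Proof.
  intros Hd Hb.
  assert (Hfin : forall n, exists M : R, forall m, (m < n)%nat -> (Cmod (b m) <= M)%R).
  { induction n as [|n [M HM]].
    - exists 0%R. lia.
    - exists (Rmax M (Cmod (b n))). intros m Hm.
      destruct (Nat.eq_dec m n) as [->|Hne].
      + apply Rmax_r.
      + eapply Rle_trans; [apply HM; lia | apply Rmax_l]. }
  destruct (Hfin d) as [M HM].
  exists M. intros m.
  induction m as [m IH] using lt_wf_ind.
  destruct (Nat.lt_ge_cases m d) as [Hlt|Hge].
  - now apply HM.
  - replace m with (d + (m - d))%nat by lia.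
    rewrite Hb. apply IH. lia.
Qed.

Lemma ex_series_pow_periodic (w : C) (b : nat -> C) (d : nat) :
  (Cmod w < 1)%R -> (0 < d)%nat -> (forall m, b (d + m)%nat = b m) ->
  ex_series (fun m => Cpow w m * b m).
Proof.
  intros Hw Hd Hb.
  destruct (periodic_bounded b d Hd Hb) as [M HM].
  apply (ex_series_le (V := C_CompleteNormedModule) _
           (fun m => scal M (Cmod w ^ m)%R)).
  - intros m. change (Cmod (Cpow w m * b m) <= M * Cmod w ^ m)%R.
    rewrite Cmod_mult, Cmod_pow, Rmult_comm.
    apply Rmult_le_compat_r; [apply pow_le, Cmod_ge_0 | apply HM].
  - apply (ex_series_scal (V := R_NormedModule) M), ex_series_geom.
    now rewrite Rabs_pos_eq by apply Cmod_ge_0.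
Qed.

(** The tail after [d] terms is [c] times the whole series, so its sum [L]
    satisfies [L - P = c * L], where [P] is the sum of the first [d] terms. *)
Lemma is_series_quasi_periodic (a : nat -> C) (c : C) (d : nat) :
  (0 < d)%nat -> c <> 1 -> (forall m, a (d + m)%nat = c * a m) ->
  ex_series a -> is_series a (sum_n a (pred d) / (1 - c)).
Proof.
  intros Hd Hc Ha [L HL].
  change (NormedModule.sort C_AbsRing C_NormedModule) with C in L.
  set (P := sum_n a (pred d) : C).
  assert (Htail : is_series (fun m => a (d + m)%nat) (L - P)).
  { apply is_series_incr_n; [exact Hd|].
    change (is_series a (L - P + P)).
    now replace (L - P + P) with L by ring. }
  assert (Hscal : is_series (fun m => a (d + m)%nat) (c * L)).
  { apply is_series_ext with (fun m => scal c (a m)).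
    - intros m. now rewrite Ha.
    - now apply (is_series_scal (V := C_NormedModule) c a L). }
  assert (E : L - P = c * L).
  { exact (filterlim_locally_unique (V := C_NormedModule) _ _ _ Htail Hscal). }
  assert (Hc' : 1 - c <> 0).
  { intros H. apply Hc. replace c with (1 - (1 - c)) by ring. rewrite H. ring. }
  replace (P / (1 - c)) with L; [exact HL|].
  replace P with (L - (L - P)) by ring. rewrite E. field. exact Hc'.
Qed.

Lemma qL_term_0 (q logq : C) (chi : Z -> C) (alpha : nat) (x : R) (m : nat) :
  qL_term q logq chi alpha 0 x m = Cpow (- q) m * chi (Z.of_nat m).
Proof.
  unfold qL_term. rewrite Cpower_0_r.
  replace (- q) with (- (1) * q) by ring.
  rewrite Cpow_mult_l. field.
Qed.

Theorem theorem8 (q logq : C) (alpha d : nat) (chi : Z -> C) (x : R)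
  (hq0 : (0 < Cmod q)%R) (hq1 : (Cmod q < 1)%R)
  (hlog : Cexp logq = q)
  (halpha : (0 < alpha)%nat)
  (hd : Nat.Odd d)
  (hchi : dirichlet_character_of_conductor d chi)
  (hx : (0 < x)%R) :
  ex_series (qL_term q logq chi alpha 0 x) /\
  qL q logq chi alpha 0 x =
    qbracket 2 logq / qbracket 2 (RtoC (INR d) * logq) *
    sum_n (fun l : nat => Cpow (- (1)) l * chi (Z.of_nat l) * Cpow q l) (d - 1).
Proof.
  destruct hchi as [[Hd [_ [_ [Hper _]]]] _].
  assert (Hw : (Cmod (- q) < 1)%R) by now rewrite Cmod_opp.
  set (a := fun m => Cpow (- q) m * chi (Z.of_nat m)).
  assert (Hb : forall m, chi (Z.of_nat (d + m)) = chi (Z.of_nat m)).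
  { intros m. now rewrite Nat2Z.inj_add, Z.add_comm, Hper. }
  assert (Hex : ex_series a).
  { exact (ex_series_pow_periodic (- q) (fun m => chi (Z.of_nat m)) d Hw Hd Hb). }
  assert (Hsum := is_series_quasi_periodic a (Cpow (- q) d) d Hd
                    (Cmod_lt_1_neq_1 _ (Cmod_pow_lt_1 _ d Hd Hw))).
  assert (Hser : is_series (qL_term q logq chi alpha 0 x)
                   (sum_n a (pred d) / (1 - Cpow (- q) d))).
  { apply is_series_ext with a.
    - intros m. now rewrite qL_term_0.
    - apply Hsum; [|exact Hex].
      intros m. unfold a. rewrite Hb, Cpow_add_r. ring. }
  split; [eexists; exact Hser|].
  unfold qL. rewrite (CSeries_unique _ _ Hser).
  assert (Hqd : Cexp (RtoC (INR d) * logq) = Cpow q d).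
  { now rewrite Cexp_INR_mult, hlog. }
  assert (Hq : Cpow q d <> 1) by now apply Cmod_lt_1_neq_1, Cmod_pow_lt_1.
  rewrite (qbracket_2 (RtoC (INR d) * logq)) by now rewrite Hqd.
  rewrite Hqd.
  rewrite Cpow_opp_odd by exact hd.
  replace (1 - - Cpow q d) with (1 + Cpow q d) by ring.
  replace (d - 1)%nat with (pred d) by lia.
  rewrite (sum_n_ext (fun l => Cpow (- (1)) l * chi (Z.of_nat l) * Cpow q l) a).
  - change (@eq C (qbracket 2 logq * (sum_n a (pred d) / (1 + Cpow q d)))
              (qbracket 2 logq / (1 + Cpow q d) * sum_n a (pred d))).
    unfold Cdiv. ring.
  - intros l. change (@eq C (Cpow (- (1)) l * chi (Z.of_nat l) * Cpow q l) (a l)).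
    unfold a. replace (- q) with (- (1) * q) by ring.
    rewrite Cpow_mult_l. ring.
Qed.
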